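(* Let $G$ be a relatively hyperbolic group with a finite generating set $S$, acting geometrically finitely on $\Lambda G$, and let $o\in G$ be a basepoint. There exists $0<\lambda_0<1$ such that for any $L>0$ and $\lambda\in[\lambda_0,1)$ there is a constant $C\ge1$ with $$C^{-1}\lambda^{n}\le\rho_{\lambda,o}(\xi,\eta)\le C\lambda^{n}\qquad\text{for all }\xi\neq\eta\in\partial^{uc}_{L,o}G,$$ and $$C^{-1}\lambda^{n}\le\bar\rho_{\lambda,o}(\xi,\eta)\le C\lambda^{n}\qquad\text{for all }\xi\neq\eta\in\Lambda^{uc}_{L,o}G,$$ where in each case $n=d(o,[\xi,\eta])$ is the word distance from $o$ to a bi-infinite geodesic $[\xi,\eta]$ of the Cayley graph with endpoints $\xi,\eta$.
   Context: Convergence actions. All actions $G\curvearrowright X$ are convergence actions on compact metrizable spaces (properly discontinuous on distinct triples). The limit set is the set of accumulation points of orbits; the action is minimal if $X$ equals its limit set. $\xi\in X$ is conical if there are pairwise distinct $g_n\in G$ such that for every $\eta\in X\setminus\{\xi\}$ the closure of $\{(g_n\xi,g_n\eta):n\ge1\}$ in $X^2$ is disjoint from the diagonal; it is uniformly conical if in addition $d(1,g_ng_{n+1}^{-1})\le L'$ for all $n$, for some $L'>0$. $\xi$ is bounded parabolic if its stabilizer (then called maximal parabolic) is infinite and acts properly and cocompactly on $X\setminus\{\xi\}$. The action is geometrically finite if it is minimal, without global fixed point, and every point is conical or bounded parabolic; then $X=\Lambda G$. A finitely generated group admitting such an action is relatively hyperbolic. Floyd and shortcut metrics. $1\notin S=S^{-1}$,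 $d=d_S$ is the word metric. Give each edge $e$ of the Cayley graph $\mathscr G(G,S)$ the length $\lambda^{d(o,e)}$; the Floyd metric $\rho_{\lambda,o}$ is the induced length metric, $\overline G_\lambda$ the Cauchy completion, $\partial_\lambda G=\overline G_\lambda\setminus\mathscr G(G,S)$; $G$ acts on $\partial_\lambda G$ as a convergence group. There is $\lambda_1\in(0,1)$ such that for all $\lambda\in[\lambda_1,1)$ (always assumed) there is a continuous equivariant surjection $F_\lambda:\partial_\lambda G\to\Lambda G$ (Floyd map), extended by the identity on $\mathscr G(G,S)$. Let $\omega=\{(\xi,\eta)\in\partial_\lambda G\times\partial_\lambda G:F_\lambda(\xi)=F_\lambda(\eta)\}$ and $\tilde\rho_{\lambda,o}(\xi,\eta)=\inf\sum_{i=1}^n\rho_{\lambda,o}(\xi_i,\eta_i)$ over all $n\ge1$ and chains with $\xi_1=\xi,\eta_n=\eta$, $(\eta_i,\xi_{i+1})\in\omega$ for $1\le i<n$. The shortcut metric on $\Lambda G\sqcup\mathscr G(G,S)$ is $\bar\rho_{\lambda,o}(x,y)=\tilde\rho_{\lambda,o}(F_\lambda^{-1}(x),F_\lambda^{-1}(y))$, a well-defined metric. Word-geodesic rays converge in $\overline G_\lambda$ to points of $\partial_\lambda G$; a ray ends at $\xi\in\Lambda G$ if its endpoint in $\partial_\lambda G$ lies in $F_\lambda^{-1}(\xi)$. Any two distinct points of $\partial_\lambda G$ (or of $\Lambda G$) are the endpoints of a bi-infinite geodesic of $\mathscr G(G,S)$. Horospheres and transition points. $\mathbb P=\{gP\}$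 is the set of left cosets of a set of conjugacy representatives $P$ of the maximal parabolic subgroups. For a path $\gamma$ and vertex $v\in\gamma$: $v$ is $(\varepsilon,R)$-deep in $X\in\mathbb P$ if $\gamma\cap B(v,R)\subset N_\varepsilon(X)$; $v$ is an $(\varepsilon,R)$-transition point if it is not $(\varepsilon,R)$-deep in any $X\in\mathbb P$. $\gamma$ is $(\varepsilon,R,L)$-transitional if for every $v\in\gamma$ there is an $(\varepsilon,R)$-transition point $w\in\gamma$ with the length of $[v,w]_\gamma$ at most $L$; an infinite path is eventually $(\varepsilon,R,L)$-transitional if some terminal subpath is $(\varepsilon,R,L)$-transitional. Constants. There are $\mu_1,D_1>0$ with $\operatorname{diam}\mathbf{Proj}_X(\gamma)<D_1$ (nearest-point projection) for all $X\in\mathbb P$ and geodesics $\gamma$ with $\gamma\cap N_{\mu_1}(X)=\emptyset$, and a function $\mathcal R$ with $\operatorname{diam}(N_\varepsilon(X)\cap N_\varepsilon(X'))<\mathcal R(\varepsilon)$ for $X\ne X'$ in $\mathbb P$. The pair $(\varepsilon,R)$ is fixed so that (a) $\varepsilon>\mu_1$; (b) for every $\lambda\in[\lambda_1,1)$ there is $\kappa>0$ with $\bar\rho_{\lambda,v}(\gamma_-,\gamma_+)>\kappa$ for every geodesic $\gamma$ and $(\varepsilon,R)$-transition point $v$ of $\gamma$; (c) for all $\varepsilon'\ge\varepsilon$, $R'\ge0$ there is $L'>0$ such that if $\gamma$ is a geodesic and $X\in\mathbb P$ with $d(\gamma_\pm,X)<\varepsilon'$, then every $z\in\gamma$ with $d(z,\gamma_\pm)>L'$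 is $(\varepsilon,R')$-deep in $X$; (d) $R>\mathcal R(\varepsilon)$; (e) $\xi\in\Lambda G$ is uniformly conical iff some (equivalently any) geodesic ray ending at $\xi$ is eventually $(\varepsilon,R,L)$-transitional for some $L>0$. Sets. $\Lambda^{uc}_{L,o}G$ (resp. $\partial^{uc}_{L,o}G$) is the set of uniformly conical points $\xi\in\Lambda G$ (resp. $\xi\in\partial_\lambda G$) for which there is an $(\varepsilon,R,L)$-transitional geodesic ray from $o$ ending at $\xi$. *)

(* Defs.v *)
From HB Require Import structures.
From mathcomp Require Import all_boot all_order all_algebra.
From mathcomp Require Import all_classical all_reals all_analysis.
From mathcomp Require Import lra.

Set Implicit Arguments.
Unset Strict Implicit.
Unset Printing Implicit Defensive.

Import Order.TTheory GRing.Theory Num.Theory.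
Import numFieldNormedType.Exports.

Local Open Scope classical_set_scope.
Local Open Scope ring_scope.

Record pseudo_dist (R : realType) (T : Type) := PseudoDist {
  pdist :> T -> T -> R;
  pdistxx : forall x, pdist x x = 0;
  pdist_sym : forall x y, pdist x y = pdist y x;
  pdist_triangle : forall y x z, pdist x z <= pdist x y + pdist y z }.

Section Completion.
Variables (R : realType) (T : choiceType) (d : pseudo_dist R T).

Lemma pdist_ge0 x y : 0 <= d x y.
Proof.
have := pdist_triangle d y x x; rewrite pdistxx (pdist_sym d y x); lra.
Qed.

Definition cauchy_for (u : nat -> T) : Prop :=
  forall e : R, 0 < e -> exists N : nat,
    forall m n, (N <= m)%N -> (N <= n)%N -> d (u m) (u n) < e.

Definition cauchy_seqs : choiceType := set_type [set u | cauchy_for u].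

Definition cauchy_equiv (u v : cauchy_seqs) : bool :=
  `[< (fun n => d (val u n) (val v n)) @ \oo --> (0 : R) >].

Lemma cauchy_equivP (u v : cauchy_seqs) :
  reflect (forall e : R, 0 < e -> exists N : nat,
             forall n, (N <= n)%N -> d (val u n) (val v n) < e)
          (cauchy_equiv u v).
Proof.
apply: (iffP (asboolP _)) => [/cvgrPdist_lt H e e0|H].
  have [N _ HN] := H e e0; exists N => n /HN.
  by rewrite /= sub0r normrN ger0_norm// pdist_ge0.
apply/cvgrPdist_lt => e e0; have [N HN] := H e e0.
exists N => // n /= /HN.
by rewrite sub0r normrN ger0_norm// pdist_ge0.
Qed.

Lemma cauchy_equiv_is_equiv : equiv_class_of cauchy_equiv.
Proof.
split.
- move=> u; apply/cauchy_equivP => e e0; exists 0%N => n _.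
  by rewrite pdistxx.
- move=> u v; apply/idP/idP => /cauchy_equivP H; apply/cauchy_equivP => e e0;
    have [N HN] := H e e0; exists N => n /HN; by rewrite pdist_sym.
- move=> v u w /cauchy_equivP Huv /cauchy_equivP Hvw.
  apply/cauchy_equivP => e e0.
  have e20 : 0 < e / 2 by lra.
  have [N HN] := Huv _ e20; have [M HM] := Hvw _ e20.
  exists (maxn N M) => n; rewrite geq_max => /andP[/HN h1 /HM h2].
  have := pdist_triangle d (val v n) (val u n) (val w n); lra.
Qed.

Canonical cauchy_equiv_equiv := EquivRelPack cauchy_equiv_is_equiv.

Definition completion := {eq_quot cauchy_equiv}%qT.
HB.instance Definition _ := Choice.on completion.

Definition completion_class (u : nat -> T) (cu : cauchy_for u) : completion :=
  (\pi_({eq_quot cauchy_equiv}%qT) (exist _ u (mem_set cu)))%qT.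

Definition completion_seq (x : completion) : nat -> T :=
  val (repr (x : {eq_quot cauchy_equiv}%qT)).

Lemma completion_seq_cauchy x : cauchy_for (completion_seq x).
Proof. by have := set_valP (repr (x : {eq_quot cauchy_equiv}%qT)). Qed.

Lemma completion_eqP (x y : completion) :
  (forall e : R, 0 < e -> exists N : nat, forall n, (N <= n)%N ->
     d (completion_seq x n) (completion_seq y n) < e) <-> x = y.
Proof.
split=> [H|->]; last first.
  by move=> e e0; exists 0%N => n _; rewrite pdistxx.
have /eqmodP : cauchy_equiv (repr (x : {eq_quot cauchy_equiv}%qT))
    (repr (y : {eq_quot cauchy_equiv}%qT)) by apply/cauchy_equivP.
by rewrite !reprK.
Qed.

Lemma completion_class_seq u (cu : cauchy_for u) :
  forall e : R, 0 < e -> exists N : nat, forall n, (N <= n)%N ->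
    d (completion_seq (completion_class cu) n) (u n) < e.
Proof.
suff /cauchy_equivP : cauchy_equiv
  (repr (completion_class cu : {eq_quot cauchy_equiv}%qT))
  (exist _ u (mem_set cu)) by [].
by apply/eqmodP; rewrite reprK.
Qed.

Lemma completion_class_eqP u (cu : cauchy_for u) v (cv : cauchy_for v) :
  (forall e : R, 0 < e -> exists N : nat, forall n, (N <= n)%N ->
     d (u n) (v n) < e) <-> completion_class cu = completion_class cv.
Proof.
split=> [H|/eqmodP /cauchy_equivP//].
by apply/eqmodP/cauchy_equivP.
Qed.

Lemma completion_classK x :
  completion_class (@completion_seq_cauchy x) = x.
Proof.
by apply/completion_eqP => e e0; apply: completion_class_seq.
Qed.

Definition completion_lim (f : T -> T -> R) (x y : completion) : R :=
  limn (fun n => f (completion_seq x n) (completion_seq y n)).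

Definition completion_dist := completion_lim d.

Lemma completion_dist_cvg (x y : completion) :
  (fun n => d (completion_seq x n) (completion_seq y n)) @ \oo -->
  completion_dist x y.
Proof.
suff : cvgn (fun n => d (completion_seq x n) (completion_seq y n)) by [].
apply/(@cauchy_cvgP R).
apply: cauchy_exP => e e0.
have e20 : 0 < e / 2 by lra.
have [N HN] := @completion_seq_cauchy x _ e20.
have [M HM] := @completion_seq_cauchy y _ e20.
pose K := maxn N M.
have KN : (N <= K)%N by rewrite leq_maxl.
have KM : (M <= K)%N by rewrite leq_maxr.
exists (d (completion_seq x K) (completion_seq y K)).
exists K => // n /= Kn.
have hx := HN _ _ KN (leq_trans KN Kn).
have hy := HM _ _ KM (leq_trans KM Kn).
set a := completion_seq x K in hx *; set b := completion_seq y K in hy *.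
set a' := completion_seq x n in hx *; set b' := completion_seq y n in hy *.
have h1 := pdist_triangle d a' a b; have h2 := pdist_triangle d b' a' b.
have h3 := pdist_triangle d a a' b'; have h4 := pdist_triangle d b a b'.
have h5 := pdist_sym d a a'; have h6 := pdist_sym d b b'.
by rewrite /ball/= ltr_norml; apply/andP; split; lra.
Qed.

Lemma completion_distxx x : completion_dist x x = 0.
Proof.
apply/(@cvg_lim R) => //.
rewrite (_ : (fun n => _) = cst 0); first exact: cvg_cst.
by apply/funext => n; rewrite pdistxx.
Qed.

Lemma completion_dist_positivity x y : completion_dist x y = 0 -> x = y.
Proof.
move=> xy; apply/completion_eqP => e e0.
have := @completion_dist_cvg x y; rewrite xy => /cvgrPdist_lt /(_ e e0)[N _ HN].
by exists N => n /HN /=; rewrite sub0r normrN ger0_norm// pdist_ge0.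
Qed.

Lemma completion_dist_sym x y : completion_dist x y = completion_dist y x.
Proof.
rewrite /completion_dist /completion_lim; congr (lim (_ @ \oo)).
by apply/funext => n; rewrite pdist_sym.
Qed.

Lemma completion_dist_triangle y x z :
  completion_dist x z <= completion_dist x y + completion_dist y z.
Proof.
have Cxz := @completion_dist_cvg x z.
have Cxyz : (fun n => d (completion_seq x n) (completion_seq y n) +
    d (completion_seq y n) (completion_seq z n)) @ \oo -->
    completion_dist x y + completion_dist y z.
  by apply: (@cvgD R R); exact: completion_dist_cvg.
rewrite -(cvg_lim (@Rhausdorff R) Cxyz) -(cvg_lim (@Rhausdorff R) Cxz).
apply: ler_lim; [exact: cvgP Cxz|exact: cvgP Cxyz|].
by apply: nearW => n; exact: pdist_triangle.
Qed.

HB.instance Definition _ := isMetric.Build R completion completion_distxx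
  completion_dist_positivity completion_dist_sym completion_dist_triangle.

Lemma cauchy_for_cst (x : T) : cauchy_for (fun=> x).
Proof. by move=> e e0; exists 0%N => m n _ _; rewrite pdistxx. Qed.

Definition completion_in (x : T) : completion :=
  completion_class (@cauchy_for_cst x).

End Completion.

Record gen_set (G : groupType) := GenSet {
  gens : seq G;
  gens_not1 : 1%g \notin gens;
  gensV : forall s, s \in gens -> (s^-1)%g \in gens;
  gens_generate : forall g, exists2 w : seq G,
    {subset w <= gens} & g = (\prod_(s <- w) s)%g }.

Section WordMetric.
Variables (G : groupType) (S : gen_set G).

Definition word_of_len (g : G) (n : nat) : Prop :=
  exists w : seq G,
    [/\ size w = n, {subset w <= gens S} & g = (\prod_(s <- w) s)%g].

Lemma word_of_len_ex g : exists n, `[< word_of_len g n >].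
Proof.
have [w wS gw] := gens_generate S g.
by exists (size w); apply/asboolP; exists w.
Qed.

Definition word_len (g : G) : nat := ex_minn (word_of_len_ex g).

Definition word_dist (x y : G) : nat := word_len (x^-1 * y)%g.

Lemma word_lenP g : word_of_len g (word_len g).
Proof. by rewrite /word_len; case: ex_minnP => m /asboolP. Qed.

Lemma word_len_le g n : word_of_len g n -> (word_len g <= n)%N.
Proof.
by move=> gn; rewrite /word_len; case: ex_minnP => m _; apply; apply/asboolP.
Qed.

Lemma word_len1 : word_len 1%g = 0%N.
Proof.
apply/eqP; rewrite -leqn0; apply: word_len_le; exists [::].
by split=> //; rewrite big_nil.
Qed.

Lemma word_lenM g h : (word_len (g * h)%g <= word_len g + word_len h)%N.
Proof.
apply: word_len_le.
have [v [vn vS gv]] := word_lenP g; have [w [wn wS hw]] := word_lenP h.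
exists (v ++ w); split.
- by rewrite size_cat vn wn.
- by move=> s; rewrite mem_cat => /orP[/vS|/wS].
- by rewrite big_cat/= {1}gv {1}hw.
Qed.

Lemma word_lenV g : word_len (g^-1)%g = word_len g.
Proof.
suff H h : (word_len (h^-1)%g <= word_len h)%N.
  by apply/eqP; rewrite eqn_leq H/= -{1}(invgK g) H.
apply: word_len_le; have [w [<- wS ->]] := word_lenP h.
exists (rev [seq (s^-1)%g | s <- w]); split.
- by rewrite size_rev size_map.
- by move=> s; rewrite mem_rev => /mapP[t /wS tS ->]; exact: gensV.
- elim: w {wS} => [|a w IH]; first by rewrite !big_nil invg1.
  by rewrite big_cons invgM IH /= rev_cons -cats1 big_cat/= big_seq1.
Qed.

Lemma word_distxx x : word_dist x x = 0%N.
Proof. by rewrite /word_dist mulVg word_len1. Qed.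

Lemma word_dist_sym x y : word_dist x y = word_dist y x.
Proof. by rewrite /word_dist -word_lenV invgM invgK. Qed.

Lemma word_dist_triangle y x z :
  (word_dist x z <= word_dist x y + word_dist y z)%N.
Proof.
rewrite /word_dist; apply: leq_trans (word_lenM _ _).
by rewrite -mulgA mulVKg.
Qed.

Lemma word_distM g x y : word_dist (g * x)%g (g * y)%g = word_dist x y.
Proof. by rewrite /word_dist invgM -mulgA mulKg. Qed.

Definition adj (x y : G) : bool := (x^-1 * y)%g \in gens S.

Lemma adj_sym x y : adj x y = adj y x.
Proof.
by apply/idP/idP; rewrite /adj => /gensV; rewrite invgM invgK.
Qed.

Lemma adjM g x y : adj (g * x)%g (g * y)%g = adj x y.
Proof. by rewrite /adj invgM -mulgA mulKg. Qed.

Lemma adj_connected x y : exists2 p, path adj x p & last x p = y.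
Proof.
have [w wS] := gens_generate S (x^-1 * y)%g.
move/(congr1 (fun z => x * z)%g); rewrite mulVKg => ->.
elim: w wS x => [|a w IH] wS x.
  by exists [::] => //=; rewrite big_nil mulg1.
have [|p xp lp] := IH _ (x * a)%g.
  by move=> s sw; apply: wS; rewrite in_cons sw orbT.
exists ((x * a)%g :: p) => /=.
  by rewrite xp andbT /adj mulKg wS// mem_head.
by rewrite lp big_cons mulgA.
Qed.

(* For A nonempty this is the minimum of word_dist x a for a in A. *)
Definition set_dist (x : G) (A : set G) : nat :=
  xget 0%N [set n | (exists2 a, A a & word_dist x a = n) /\
                    forall a, A a -> (n <= word_dist x a)%N].

End WordMetric.

Section Floyd.
Variables (R : realType) (G : groupType) (S : gen_set G).
Variable lam : {itv R & `]0, 1[}.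

(* The length of the edge {x, y}; minn _ _ is the distance from o to it. *)
Definition floyd_edge (o x y : G) : R :=
  lam%:num ^+ minn (word_dist S o x) (word_dist S o y).

Definition floyd_len (o x : G) (p : seq G) : R :=
  \sum_(e <- pairmap pair x p) floyd_edge o e.1 e.2.

Definition floyd_metric (o x y : G) : R :=
  inf [set floyd_len o x p | p in [set p | path (adj S) x p /\ last x p = y]].

Lemma floyd_edge_ge0 o x y : 0 <= floyd_edge o x y.
Proof. by rewrite /floyd_edge exprn_ge0. Qed.

Lemma floyd_len_ge0 o x p : 0 <= floyd_len o x p.
Proof. by rewrite /floyd_len sumr_ge0// => e _; exact: floyd_edge_ge0. Qed.

Lemma floyd_len_nil o x : floyd_len o x [::] = 0.
Proof. by rewrite /floyd_len big_nil. Qed.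

Lemma floyd_len_cons o x y p :
  floyd_len o x (y :: p) = floyd_edge o x y + floyd_len o y p.
Proof. by rewrite /floyd_len/= big_cons. Qed.

Lemma floyd_len_cat o x p q :
  floyd_len o x (p ++ q) = floyd_len o x p + floyd_len o (last x p) q.
Proof.
elim: p x => [|a p IH] x; first by rewrite floyd_len_nil add0r.
by rewrite cat_cons !floyd_len_cons IH addrA.
Qed.

Lemma floyd_len_rev o x p :
  floyd_len o (last x p) (rev (belast x p)) = floyd_len o x p.
Proof.
elim: p x => [|a p IH] x //.
rewrite [last _ _]/= [belast _ _]/= rev_cons -cats1 floyd_len_cat IH.
rewrite [RHS]floyd_len_cons [RHS]addrC; congr (_ + _).
have -> : last (last a p) (rev (belast a p)) = a.
  case: p {IH} => [|b p] //=.
  by rewrite rev_cons last_rcons.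
rewrite floyd_len_cons floyd_len_nil addr0.
by rewrite /floyd_edge minnC.
Qed.

Let lens o x y :=
  [set floyd_len o x p | p in [set p | path (adj S) x p /\ last x p = y]].

Let lens_lb o x y : has_lbound (lens o x y).
Proof. by exists 0 => _ [p _ <-]; exact: floyd_len_ge0. Qed.

Let lens_n0 o x y : lens o x y !=set0.
Proof.
have [p xp lp] := adj_connected S x y.
by exists (floyd_len o x p), p.
Qed.

Lemma floyd_metric_le o x p :
  path (adj S) x p -> floyd_metric o x (last x p) <= floyd_len o x p.
Proof. by move=> xp; apply: ge_inf; [exact: lens_lb|exists p]. Qed.

Lemma floyd_metric_glb o x y r :
  (forall p, path (adj S) x p -> last x p = y -> r <= floyd_len o x p) ->
  r <= floyd_metric o x y.
Proof.
move=> H; apply: lb_le_inf; first exact: lens_n0.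
by move=> _ [p [xp lp] <-]; exact: H.
Qed.

Lemma floyd_metricxx o x : floyd_metric o x x = 0.
Proof.
apply/le_anti/andP; split.
  by have := @floyd_metric_le o x [::] isT; rewrite floyd_len_nil.
by apply: floyd_metric_glb => p _ _; exact: floyd_len_ge0.
Qed.

Lemma floyd_metric_sym o x y : floyd_metric o x y = floyd_metric o y x.
Proof.
suff H a b : floyd_metric o a b <= floyd_metric o b a.
  by apply/le_anti; rewrite !H.
apply: floyd_metric_glb => p bp <-; rewrite -(floyd_len_rev o b p).
have lb : last (last b p) (rev (belast b p)) = b.
  by case: p bp => [|c p] _ //=; rewrite rev_cons last_rcons.
rewrite -{2}lb; apply: floyd_metric_le.
by rewrite rev_path; rewrite (eq_path (e' := adj S))// => u v; exact: adj_sym.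
Qed.

Lemma floyd_metric_triangle o y x z :
  floyd_metric o x z <= floyd_metric o x y + floyd_metric o y z.
Proof.
rewrite -lerBlDr; apply: floyd_metric_glb => p xp lp.
rewrite lerBlDr -lerBlDl; apply: floyd_metric_glb => q yq lq.
rewrite lerBlDl -lp -(floyd_len_cat o x p q).
have <- : last x (p ++ q) = z by rewrite last_cat lp.
by apply: floyd_metric_le; rewrite cat_path xp lp.
Qed.

Definition floyd_dist (o : G) : pseudo_dist R G :=
  PseudoDist (floyd_metricxx o) (@floyd_metric_sym o) (@floyd_metric_triangle o).

End Floyd.

Section FloydBoundary.
Variables (R : realType) (G : groupType) (S : gen_set G).
Variables (lam : {itv R & `]0, 1[}) (o : G).

Let rho := floyd_metric S lam o.

Lemma floyd_edge_translate g x y :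
  lam%:num ^+ word_dist S o (g * o)%g *
    floyd_edge S lam o (g * x)%g (g * y)%g <= floyd_edge S lam o x y.
Proof.
rewrite /floyd_edge -exprD; apply: ler_wiXn2l; [by []|exact/ltW|].
have H z : (word_dist S o z <=
    word_dist S o (g * o)%g + word_dist S o (g * z)%g)%N.
  rewrite -(word_distM S g o z) (word_dist_sym S o (g * o)%g).
  exact: word_dist_triangle.
by rewrite addn_minr leq_min !geq_min !H orbT.
Qed.

Lemma floyd_metric_translate g x y :
  lam%:num ^+ word_dist S o (g * o)%g * rho (g * x)%g (g * y)%g <= rho x y.
Proof.
apply: floyd_metric_glb => p xp lp.
pose q := [seq (g * z)%g | z <- p].
have gq : path (adj S) (g * x)%g q.
  rewrite path_map; rewrite (eq_path (e' := adj S))// => u v.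
  exact: adjM.
have lq : last (g * x)%g q = (g * y)%g by rewrite last_map lp.
have := floyd_metric_le lam o gq; rewrite lq => /(ler_wpM2l _) H.
apply: le_trans (H _ _) _; first exact: exprn_ge0.
rewrite /q; elim: p x {xp lp gq lq q H} => [|a p IH] x.
  by rewrite !floyd_len_nil mulr0.
rewrite map_cons !floyd_len_cons mulrDr; apply: lerD => //.
exact: floyd_edge_translate.
Qed.

(* The Cayley graph is represented by its vertex set G. Adding the interiors of
   the edges changes neither the distances between vertices nor the points of
   the completion that lie outside the graph. *)
Definition floyd_completion := completion (floyd_dist S lam o).

Definition vertex (x : G) : floyd_completion :=
  completion_in (floyd_dist S lam o) x.

Lemma floyd_small g (u v : nat -> G) :
  (forall e : R, 0 < e -> exists N : nat, forall n, (N <= n)%N ->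
     rho (u n) (v n) < e) ->
  (forall e : R, 0 < e -> exists N : nat, forall n, (N <= n)%N ->
     rho (g * u n)%g (g * v n)%g < e).
Proof.
move=> H e e0.
have k0 : 0 < lam%:num ^+ word_dist S o (g * o)%g by rewrite exprn_gt0.
have [N HN] := H _ (mulr_gt0 k0 e0).
exists N => n /HN /(le_lt_trans (floyd_metric_translate g _ _)).
by rewrite ltr_pM2l.
Qed.

Lemma floyd_cauchy_translate g (u : nat -> G) :
  cauchy_for (floyd_dist S lam o) u ->
  cauchy_for (floyd_dist S lam o) (fun n => g * u n)%g.
Proof.
move=> cu e e0.
have k0 : 0 < lam%:num ^+ word_dist S o (g * o)%g by rewrite exprn_gt0.
have [N HN] := cu _ (mulr_gt0 k0 e0).
exists N => m n Nm Nn.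
have := HN _ _ Nm Nn => /(le_lt_trans (floyd_metric_translate g _ _)).
by rewrite ltr_pM2l.
Qed.

Definition completion_act (g : G) (x : floyd_completion) : floyd_completion :=
  completion_class (floyd_cauchy_translate g (completion_seq_cauchy x)).

Lemma completion_act_class g u (cu : cauchy_for (floyd_dist S lam o) u) :
  completion_act g (completion_class cu) =
  completion_class (floyd_cauchy_translate g cu).
Proof.
by apply/completion_class_eqP; apply: floyd_small (completion_class_seq cu).
Qed.

Lemma completion_act_vertex g x : completion_act g (vertex x) = vertex (g * x)%g.
Proof.
rewrite /vertex /completion_in completion_act_class.
by apply/completion_class_eqP => e e0; exists 0%N => n _; rewrite pdistxx.
Qed.

Lemma completion_actM g h x :
  completion_act (g * h)%g x = completion_act g (completion_act h x).
Proof.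
rewrite [completion_act h x]/completion_act completion_act_class.
apply/completion_class_eqP => e e0; exists 0%N => n _.
by rewrite mulgA pdistxx.
Qed.

Lemma completion_act1 x : completion_act 1%g x = x.
Proof.
rewrite -[RHS]completion_classK; apply/completion_class_eqP => e e0.
by exists 0%N => n _; rewrite mul1g pdistxx.
Qed.

Definition floyd_boundary := set_type (~` range vertex).

Lemma boundary_act_subproof g (z : floyd_boundary) :
  completion_act g (val z) \in ~` range vertex.
Proof.
apply/mem_set => -[h _ hz]; have := set_valP z; apply.
exists (g^-1 * h)%g => //.
by rewrite -completion_act_vertex hz -completion_actM mulVg completion_act1.
Qed.

Definition boundary_act (g : G) (z : floyd_boundary) : floyd_boundary :=
  exist _ (completion_act g (val z)) (boundary_act_subproof g z).

(* The metric rho_{lam, v} on the completion for rho_{lam, o}: the two metrics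
   are bi-Lipschitz on G, so they have the same completion. *)
Definition floyd_rho (v : G) : floyd_completion -> floyd_completion -> R :=
  completion_lim (floyd_metric S lam v).

Definition boundary_rho (v : G) (z w : floyd_boundary) : R :=
  floyd_rho v (val z) (val w).

End FloydBoundary.

Section Actions.
Variables (G : groupType) (T : topologicalType) (act : G -> T -> T).

Definition is_action : Prop :=
  (forall x, act 1%g x = x) /\
  (forall g h x, act (g * h)%g x = act g (act h x)).

Definition distinct_triples : set (T * T * T) :=
  [set t | [/\ t.1.1 <> t.1.2, t.1.1 <> t.2 & t.1.2 <> t.2]].

Definition act3 (g : G) (t : T * T * T) : T * T * T :=
  (act g t.1.1, act g t.1.2, act g t.2).

Definition convergence_action : Prop :=
  [/\ is_action, forall g, continuous (act g) &
      forall K : set (T * T * T), compact K -> K `<=` distinct_triples ->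
        finite_set [set g | (act3 g @` K) `&` K !=set0]].

Definition limit_set : set T :=
  \bigcup_(x in [set: T]) limit_point [set act g x | g in [set: G]].

Definition separating (xi : T) (g : nat -> G) : Prop :=
  injective g /\
  forall eta, eta <> xi ->
    closure (range (fun n => (act (g n) xi, act (g n) eta)))
      `&` range (fun x : T => (x, x)) = set0.

Definition conical (xi : T) : Prop := exists g, separating xi g.

Definition uniformly_conical (S : gen_set G) (xi : T) : Prop :=
  exists g, separating xi g /\
    exists2 L' : nat, (0 < L')%N &
      forall n, (word_dist S 1 (g n * (g n.+1)^-1) <= L')%N.

Definition stabilizer (xi : T) : set G := [set g | act g xi = xi].

Definition bounded_parabolic (xi : T) : Prop :=
  [/\ infinite_set (stabilizer xi),
      forall K : set T, compact K -> K `<=` ~` [set xi] ->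
        finite_set [set g | stabilizer xi g /\ (act g @` K) `&` K !=set0] &
      exists K : set T, [/\ compact K, K `<=` ~` [set xi] &
        \bigcup_(g in stabilizer xi) (act g @` K) = ~` [set xi]]].

Definition geometrically_finite : Prop :=
  [/\ limit_set = [set: T],
      ~ (exists x, forall g, act g x = x) &
      forall x, conical x \/ bounded_parabolic x].

Definition maximal_parabolic (H : set G) : Prop :=
  exists2 xi, bounded_parabolic xi & H = stabilizer xi.

Definition conj_representatives (reps : set (set G)) : Prop :=
  reps `<=` maximal_parabolic /\
  forall H, maximal_parabolic H ->
    exists! P, reps P /\ exists g, H = [set (g * p * g^-1)%g | p in P].

Definition left_cosets (reps : set (set G)) : set (set G) :=
  [set A | exists g, exists2 P, reps P & A = [set (g * p)%g | p in P]].

End Actions.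

(* A path is a map gamma from an interval D of int to the vertices; segments,
   rays and lines differ only by D. Balls and neighbourhoods are closed. *)

Section Paths.
Variables (R : realType) (G : groupType) (S : gen_set G).

Definition geodesic (D : set int) (gamma : int -> G) : Prop :=
  [/\ D !=set0,
      forall i j k, D i -> D k -> i <= j <= k -> D j &
      forall i j, D i -> D j -> word_dist S (gamma i) (gamma j) = `|i - j|%N].

Definition seg_dom (a b : int) : set int := [set i | a <= i <= b].
Definition ray_dom : set int := [set i | 0 <= i].

Definition nbhd (eps : R) (A : set G) : set G :=
  [set x | (set_dist S x A)%:R <= eps].

Definition cball (v : G) (r : R) : set G :=
  [set x | (word_dist S v x)%:R <= r].

Definition deep (eps r : R) (D : set int) (gamma : int -> G) (i : int)
    (A : set G) : Prop :=
  (gamma @` D) `&` cball (gamma i) r `<=` nbhd eps A.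

Definition transition (cosets : set (set G)) (eps r : R) (D : set int)
    (gamma : int -> G) (i : int) : Prop :=
  D i /\ forall A, cosets A -> ~ deep eps r D gamma i A.

Definition transitional (cosets : set (set G)) (eps r L : R) (D : set int)
    (gamma : int -> G) : Prop :=
  forall i, D i -> exists2 j, transition cosets eps r D gamma j &
    `|i - j|%N%:R <= L.

Definition eventually_transitional (cosets : set (set G)) (eps r L : R)
    (D : set int) (gamma : int -> G) : Prop :=
  exists2 k, D k &
    transitional cosets eps r L (D `&` [set i | k <= i]) gamma.

(* 0 is added so that the empty set has diameter 0 instead of -oo. *)
Definition diam (A : set G) : \bar R :=
  ereal_sup ([set 0%E] `|` [set (word_dist S x y)%:R%:E | x in A & y in A]).

Definition nearest_proj (A : set G) (B : set G) : set G :=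
  [set x | A x /\ exists2 y, B y & word_dist S y x = set_dist S y A].

Definition contracting (cosets : set (set G)) (mu1 D1 : R) : Prop :=
  forall A D gamma, cosets A -> geodesic D gamma ->
    (gamma @` D) `&` nbhd mu1 A = set0 ->
    (diam (nearest_proj A (gamma @` D)) < D1%:E)%E.

Definition bounded_intersection (cosets : set (set G)) (Rf : R -> R) : Prop :=
  forall eps A B, 0 <= eps -> cosets A -> cosets B -> A <> B ->
    (diam (nbhd eps A `&` nbhd eps B) < (Rf eps)%:E)%E.

Definition deep_between (cosets : set (set G)) (eps : R) : Prop :=
  forall eps' r', eps <= eps' -> 0 <= r' ->
    exists2 L' : R, 0 < L' & forall a b gamma A,
      a <= b -> geodesic (seg_dom a b) gamma -> cosets A ->
      (set_dist S (gamma a) A)%:R < eps' ->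
      (set_dist S (gamma b) A)%:R < eps' ->
      forall i, seg_dom a b i ->
        L' < (word_dist S (gamma i) (gamma a))%:R ->
        L' < (word_dist S (gamma i) (gamma b))%:R ->
        deep eps r' (seg_dom a b) gamma i A.

End Paths.

Section Shortcut.
Variables (R : realType) (G : groupType) (S : gen_set G).
Variables (lam : {itv R & `]0, 1[}) (o : G).
Variables (X : topologicalType) (act : G -> X -> X).
Variable F : floyd_boundary S lam o -> X.

Let M := floyd_completion S lam o.

Definition is_floyd_map : Prop :=
  [/\ continuous F,
      forall g z, F (boundary_act g z) = act g (F z) &
      range F = [set: X]].

Definition omega (x y : M) : Prop :=
  exists z w : floyd_boundary S lam o, [/\ val z = x, val w = y & F z = F w].

Definition shortcut_chain (x y : M) (c : M * M) (cs : seq (M * M)) : Prop :=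
  [/\ c.1 = x, (last c cs).2 = y &
      path (fun a b : M * M => `[< omega a.2 b.1 >]) c cs].

Definition shortcut_tilde (v : G) (x y : M) : R :=
  inf [set r | exists c cs, shortcut_chain x y c cs /\
                 r = \sum_(a <- c :: cs) floyd_rho v a.1 a.2].

(* The fibre of F, extended by the identity on the vertices. *)
Definition fibre (x : X + G) : set M :=
  match x with
  | inl xi => [set val z | z in F @^-1` [set xi]]
  | inr g => [set vertex S lam o g]
  end.

(* shortcut_tilde v a b does not depend on the choice of a and b in the two
   fibres. *)
Definition shortcut_rho (v : G) (x y : X + G) : R :=
  inf [set shortcut_tilde v a b | a in fibre x & b in fibre y].

Definition right_limit (gamma : int -> G) (z : floyd_boundary S lam o) : Prop :=
  (fun n : nat => vertex S lam o (gamma n%:Z)) @ \oo --> (val z : M).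

Definition left_limit (gamma : int -> G) : floyd_boundary S lam o -> Prop :=
  right_limit (fun i => gamma (- i)).

Definition ray_to (gamma : int -> G) (xi : X) : Prop :=
  exists2 z, right_limit gamma z & F z = xi.

Definition right_end (D : set int) (gamma : int -> G) (x : X + G) : Prop :=
  match x with
  | inl xi => (forall i, exists2 j, D j & i < j) /\ ray_to gamma xi
  | inr g => exists i, [/\ D i, forall j, D j -> j <= i & gamma i = g]
  end.

Definition left_end (D : set int) (gamma : int -> G) : X + G -> Prop :=
  right_end [set i | D (- i)] (fun i => gamma (- i)).

(* One-vertex geodesics have to be left out: their endpoints coincide, and
   when there is no parabolic point their vertex is a transition point, so
   that no kappa would exist. *)
Definition visible_transition (cosets : set (set G)) (eps r : R) : Prop :=
  exists2 kappa : R, 0 < kappa & forall D gamma e1 e2 i,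
    geodesic S D gamma -> (exists j k, [/\ D j, D k & j <> k]) ->
    left_end D gamma e1 -> right_end D gamma e2 ->
    transition S cosets eps r D gamma i ->
    kappa < shortcut_rho (gamma i) e1 e2.

Definition uniformly_conical_by_rays (cosets : set (set G)) (eps r : R) : Prop :=
  forall xi : X,
    (uniformly_conical act S xi <->
      exists gamma, [/\ geodesic S ray_dom gamma, ray_to gamma xi &
        exists2 L : R, 0 < L &
          eventually_transitional S cosets eps r L ray_dom gamma]) /\
    (uniformly_conical act S xi <->
      forall gamma, geodesic S ray_dom gamma -> ray_to gamma xi ->
        exists2 L : R, 0 < L &
          eventually_transitional S cosets eps r L ray_dom gamma).

Definition transitional_ray_from (cosets : set (set G)) (eps r L : R)
    (gamma : int -> G) : Prop :=
  [/\ geodesic S ray_dom gamma, gamma 0 = o &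
      transitional S cosets eps r L ray_dom gamma].

Definition uc_limit (cosets : set (set G)) (eps r L : R) : set X :=
  [set xi | uniformly_conical act S xi /\
    exists2 gamma, transitional_ray_from cosets eps r L gamma &
                   ray_to gamma xi].

Definition uc_boundary (cosets : set (set G)) (eps r L : R) :
    set (floyd_boundary S lam o) :=
  [set z | uniformly_conical (@boundary_act R G S lam o) S z /\
    exists2 gamma, transitional_ray_from cosets eps r L gamma &
                   right_limit gamma z].

Definition boundary_line (z w : floyd_boundary S lam o) (gamma : int -> G) :=
  [/\ geodesic S setT gamma, left_limit gamma z & right_limit gamma w].

Definition limit_line (xi eta : X) (gamma : int -> G) :=
  exists z w, [/\ F z = xi, F w = eta & boundary_line z w gamma].

End Shortcut.

(* Main.v *)
Require Import Defs.
From mathcomp Require Import all_boot all_order all_algebra.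
From mathcomp Require Import all_classical all_reals all_analysis.
From mathcomp Require Import zify lra.

Set Implicit Arguments.
Unset Strict Implicit.
Unset Printing Implicit Defensive.

Import Order.TTheory GRing.Theory Num.Theory.
Import numFieldNormedType.Exports.

Local Open Scope classical_set_scope.
Local Open Scope ring_scope.

(** Why the two estimates hold.  Write [rho_v] for the Floyd metric with base point
    [v].  Let [a] and [b] be transitional rays from [o] to the ends of a line [c],
    and let [delta v] be the distance between the ends of [c] as seen from [v], in
    the Floyd or in the shortcut metric.

    Two facts about Floyd metrics are used.  By Karlsson's lemma ([karlsson]) a
    geodesic that passes far from [v] has ends that are close to each other for
    [rho_v], with a bound that depends on the distance to [v] only.  By the
    hypothesis on transition points, a transition point [v] of a ray from [o] sees
    a distance larger than a fixed [kappa] between [o] and the end of the ray, in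
    the shortcut metric and therefore also in the larger Floyd metric.  Together
    they yield thin triangles at transition points: by the triangle inequality for
    [rho_v], a transition point of one side of a triangle sees [kappa / 2] along one
    of the other two sides, hence lies within a fixed distance [N] of that side.

    Transition points occur along [a] with bounded gaps.  Those that do not see the
    ends of [c] apart are close to [b]; this cannot be the case for all of them,
    since the rays [a] and [b] would then have the same end.  Let [v], at distance
    [i] from [o], be the first one with [delta v > kappa / 2].  It is at bounded
    distance from [b] ([branching_point]).

    Upper bound: go along [a] from its end to [v], cross over to [b] and follow [b]
    to its end.  This path stays at distance about [i] or more from [o], and its
    Floyd length is at most a constant times [lam ^+ i] ([fellow_rays_le]).  As
    [delta v] is large, [v] is also close to [c], so that [i] is at least the
    distance [n] from [o] to [c], up to a constant.

    Lower bound: a change of base point costs a factor [lam ^+ i], so [delta o] is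
    at least [lam ^+ i * (kappa / 2)], and it remains to see that [i] is at most
    [n], up to a constant.  Both [v] and a transition point of [b] near [v] see
    [o] far from the corresponding end of [c].  Insert the vertex of [c] nearest
    to [o] between the two.  Either this vertex is as far from [o] as [v] is,
    up to a constant, or both halves of [c] pass near [v], and then so does the
    vertex that separates them ([dist_le_line_dist]).

    Only a few properties of [delta] matter; they are the hypotheses of
    [line_comparison], which covers both metrics, for every [lam] in the given
    range. *)

(** * Word geodesics *)

Section WordGeodesics.
Variables (G : groupType) (S : gen_set G).

Lemma word_dist_gen (x s : G) :
  s \in gens S -> (word_dist S x (x * s)%g <= 1)%N.
Proof.
move=> sS; rewrite /word_dist mulKg; apply: word_len_le; exists [:: s].
by split=> [//|t|]; rewrite ?big_seq1// inE => /eqP ->.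
Qed.

Lemma word_dist_le1 (x y : G) :
  (word_dist S x y <= 1)%N -> x = y \/ adj S x y.
Proof.
rewrite /word_dist; have [w [ws wS xy]] := word_lenP S (x^-1 * y)%g.
rewrite -ws; case: w wS xy {ws} => [|s [|t w]]//= wS xy _.
  by left; rewrite -[y](mulVKg x) xy big_nil mulg1.
by right; rewrite /adj xy big_seq1 wS ?mem_head.
Qed.

Lemma shortest_path (x y : G) : exists u : nat -> G,
  [/\ u 0%N = x, u (word_dist S x y) = y &
      forall k, (k < word_dist S x y)%N -> (word_dist S (u k) (u k.+1) <= 1)%N].
Proof.
have [w [ws wS xy]] := word_lenP S (x^-1 * y)%g.
rewrite -[word_dist S x y]/(word_len S _) -ws.
exists (fun k => x * \prod_(s <- take k w) s)%g; split.
- by rewrite take0 big_nil mulg1.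
- by rewrite take_size -xy mulVKg.
- move=> k kw; rewrite (take_nth 1%g kw) -cats1 big_cat/= big_seq1 mulgA.
  by apply: word_dist_gen; apply/wS/mem_nth.
Qed.

Lemma word_dist_steps (u : nat -> G) i j : (i <= j)%N ->
  (forall k, (k < j)%N -> (word_dist S (u k) (u k.+1) <= 1)%N) ->
  (word_dist S (u i) (u j) <= j - i)%N.
Proof.
elim: j => [|j IH] ij H.
  by move: ij; rewrite leqn0 => /eqP ->; rewrite word_distxx.
move: ij; rewrite leq_eqVlt => /predU1P[->|ij]; first by rewrite word_distxx.
have := word_dist_triangle S (u j) (u i) (u j.+1).
have := H j (ltnSn _); have := IH ij (fun k kj => H k (ltnW kj)).
by move: ij; lia.
Qed.

Lemma set_dist_range (T : Type) (t0 : T) (o : G) (f : T -> G) : exists2 t,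
  word_dist S o (f t) = set_dist S o (range f) &
  forall t', (set_dist S o (range f) <= word_dist S o (f t'))%N.
Proof.
have ex : exists n, `[< exists t, word_dist S o (f t) = n >].
  by exists (word_dist S o (f t0)); apply/asboolP; exists t0.
have [n /asboolP[t tn] nmin] := ex_minnP ex.
rewrite /set_dist; case: xgetP => [m -> [[_ [t' _ <-] t'm] mmin]|/(_ n)[]].
  by exists t' => // t''; apply: mmin; exists t''.
split; first by exists (f t) => //; exists t.
by move=> _ [t' _ <-]; apply: nmin; apply/asboolP; exists t'.
Qed.

End WordGeodesics.

(** * Floyd lengths of word geodesics *)

Lemma geometric_sum_le (R : realFieldType) (mu : R) m : 0 <= mu < 1 ->
  \sum_(k < m) mu ^+ k <= (1 - mu)^-1.
Proof.
move=> /andP[mu0 mu1]; rewrite -[leRHS]mul1r ler_pdivlMr ?subr_gt0//.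
have := subrX1 mu m; have := exprn_ge0 m mu0; rewrite mulrC; lra.
Qed.

Section FloydEstimates.
Variables (R : realType) (G : groupType) (S : gen_set G).
Variable lam : {itv R & `]0, 1[}.
Implicit Types (u : nat -> G) (v x y : G).

Let lam_gt0 : 0 < lam%:num :> R. Proof. by []. Qed.
Let lam_lt1 : lam%:num < 1 :> R. Proof. by []. Qed.

Lemma exp_lam_le m n : (m <= n)%N -> lam%:num ^+ n <= lam%:num ^+ m :> R.
Proof. by move=> mn; apply: ler_wiXn2l => //; exact: ltW. Qed.

Lemma floyd_metric_rebase v o x y :
  lam%:num ^+ word_dist S o v * floyd_metric S lam v x y <=
    floyd_metric S lam o x y.
Proof.
apply: floyd_metric_glb => p xp <-.
have /(ler_wpM2l (exprn_ge0 (word_dist S o v) (ltW lam_gt0))) :=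
  floyd_metric_le lam v xp.
move=> /le_trans; apply; elim: p x {xp} => [|a p IH] x.
  by rewrite !floyd_len_nil mulr0.
rewrite !floyd_len_cons mulrDr; apply: lerD => //.
rewrite /floyd_edge -exprD; apply: exp_lam_le.
by rewrite addn_minr leq_min !geq_min !word_dist_triangle orbT.
Qed.

Lemma floyd_metric_step v x y : (word_dist S x y <= 1)%N ->
  floyd_metric S lam v x y <= floyd_edge S lam v x y.
Proof.
move=> /word_dist_le1[->|xy]; first by rewrite floyd_metricxx floyd_edge_ge0.
have := @floyd_metric_le R G S lam v x [:: y].
by rewrite /= xy floyd_len_cons floyd_len_nil addr0 => /(_ isT).
Qed.

Lemma floyd_metric_sum v u m :
  (forall k, (k < m)%N -> (word_dist S (u k) (u k.+1) <= 1)%N) ->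
  floyd_metric S lam v (u 0%N) (u m) <=
    \sum_(k < m) floyd_edge S lam v (u k) (u k.+1).
Proof.
elim: m => [|m IH] H; first by rewrite big_ord0 floyd_metricxx.
rewrite big_ord_recr/=.
apply: le_trans (floyd_metric_triangle _ _ _ (u m) _ _) _.
by apply: lerD; [apply: IH => k km; exact/H/ltnW|exact/floyd_metric_step/H].
Qed.

Lemma floyd_metric_geometric v u m (c mu : R) : 0 <= c -> 0 <= mu < 1 ->
  (forall k, (k < m)%N -> (word_dist S (u k) (u k.+1) <= 1)%N) ->
  (forall k, (k <= m)%N -> lam%:num ^+ word_dist S v (u k) <= c * mu ^+ k) ->
  floyd_metric S lam v (u 0%N) (u m) <= c / (1 - mu).
Proof.
move=> c0 mu01 /floyd_metric_sum - /(_ v) /le_trans H Hc; apply: H.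
apply: le_trans (ler_wpM2l c0 (geometric_sum_le m mu01)).
rewrite mulr_sumr; apply: ler_sum => k _; rewrite /floyd_edge.
have /andP[mu0 mu1] := mu01.
rewrite /minn; case: ltnP => _; first exact/Hc/ltnW.
apply: le_trans (Hc _ _) _ => //; apply: ler_wpM2l => //.
by rewrite exprS ler_piMl ?exprn_ge0// ltW.
Qed.

Lemma floyd_metric_escape v u m N :
  (forall k, (k < m)%N -> (word_dist S (u k) (u k.+1) <= 1)%N) ->
  (forall k, (k <= m)%N -> (N + k <= word_dist S v (u k))%N) ->
  floyd_metric S lam v (u 0%N) (u m) <= lam%:num ^+ N / (1 - lam%:num).
Proof.
move=> H HN; apply: floyd_metric_geometric => //; first by rewrite ltW/=.
by move=> k /HN kN; rewrite -exprD exp_lam_le.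
Qed.

(** The vertex that a shortest path from [y] to [x] reaches after [k] steps lies
    at distance at least [N + k] from [v]. *)
Lemma floyd_metric_shadow v x y N : (N + word_dist S x y <= word_dist S v x)%N ->
  floyd_metric S lam v x y <= lam%:num ^+ N / (1 - lam%:num).
Proof.
rewrite floyd_metric_sym word_dist_sym.
have [u] := shortest_path S y x.
move: (word_dist S y x) => m [<- <- H] HN.
apply: floyd_metric_escape => // k km.
have := word_dist_steps km H.
have := word_dist_triangle S (u k) v (u m).
by move: km HN; lia.
Qed.

Lemma floyd_metric_coarse v x y :
  floyd_metric S lam v x y <=
    (word_dist S x y)%:R * lam%:num ^+ (word_dist S v x - word_dist S x y).
Proof.
have [u] := shortest_path S x y.
move: (word_dist S x y) => m [<- <- H].
apply: le_trans (floyd_metric_sum v H) _.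
rewrite mulr_natl -[X in _ *+ X]card_ord -sumr_const; apply: ler_sum => k _.
apply: exp_lam_le; rewrite leq_min.
have D j : (j <= m)%N -> (word_dist S v (u 0%N) - m <= word_dist S v (u j))%N.
  move=> jm; have := word_dist_triangle S (u j) v (u 0%N).
  rewrite (word_dist_sym S (u j)).
  have : (word_dist S (u 0%N) (u j) <= j - 0)%N.
    by apply: word_dist_steps => // i ij; apply: H; exact: leq_trans ij jm.
  by move: jm; lia.
by rewrite !D// ltnW.
Qed.

Definition karlsson_ratio : R := Num.sqrt (Num.sqrt lam%:num).

Definition karlsson_bound (N : nat) : R :=
  2 * (karlsson_ratio ^+ N / (1 - karlsson_ratio)).

Lemma karlsson_ratio_gt0 : 0 < karlsson_ratio.
Proof. by rewrite !sqrtr_gt0. Qed.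

Lemma karlsson_ratio_lt1 : karlsson_ratio < 1.
Proof.
have sqrt_lt1 (a : R) : a < 1 -> Num.sqrt a < 1.
  by move=> a1; rewrite -[ltRHS]sqrtr1 ltr_sqrt.
by rewrite /karlsson_ratio !sqrt_lt1.
Qed.

Lemma karlsson_ratio4 : karlsson_ratio ^+ 4 = lam%:num.
Proof. by rewrite (exprM _ 2 2) !sqr_sqrtr// ltW// sqrtr_gt0. Qed.

(** Karlsson's lemma: a geodesic that stays at distance at least [N] from [v]
    is short as seen from [v].  At its point nearest to [v] the distance is some
    [m >= N], and [k] steps further it is at least [m] and at least [k - m];
    hence four times it is at least [2 * N + k], which makes the lengths of the
    edges decay geometrically with ratio the fourth root of [lam]. *)
Lemma karlsson v u m N :
  (forall i j, (i <= m)%N -> (j <= m)%N ->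
     word_dist S (u i) (u j) = `|i%:Z - j%:Z|%N) ->
  (forall i, (i <= m)%N -> (N <= word_dist S v (u i))%N) ->
  floyd_metric S lam v (u 0%N) (u m) <= karlsson_bound N.
Proof.
move=> ugeo uN; rewrite /karlsson_bound.
move: karlsson_ratio_gt0 karlsson_ratio_lt1.
move: karlsson_ratio karlsson_ratio4 => mu mu4 mu0 mu1.
case: (@arg_minnP _ (ord0 : 'I_m.+1) xpredT (fun i => word_dist S v (u i))) => //.
move=> i0 _ i0min.
have bound j k : (j <= m)%N -> `|j%:Z - i0%:Z|%N = k ->
    lam%:num ^+ word_dist S v (u j) <= mu ^+ N * mu ^+ k.
  move=> jm jk; rewrite -mu4 -exprM -exprD; apply: ler_wiXn2l; rewrite ?ltW//.
  have := i0min (Ordinal (jm : (j < m.+1)%N)) isT; rewrite /=.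
  have := uN _ (ltn_ord i0 : (i0 <= m)%N).
  have := word_dist_triangle S v (u j) (u i0).
  rewrite (word_dist_sym S (u j) v) (ugeo _ _ jm (ltn_ord i0)) jk.
  lia.
have i0m : (i0 <= m)%N := ltn_ord i0.
apply: le_trans (floyd_metric_triangle _ _ _ (u i0) _ _) _.
rewrite mulr_natl mulr2n; apply: lerD.
- rewrite floyd_metric_sym.
  have := @floyd_metric_geometric v (fun k => u (i0 - k)%N) i0 (mu ^+ N) mu.
  rewrite subn0 subnn; apply; rewrite ?exprn_ge0 ?ltW//.
  + move=> k ki; rewrite ugeo ?(leq_trans (leq_subr _ _))//; lia.
  + move=> k ki; apply: bound; [exact: leq_trans (leq_subr _ _) i0m|lia].
- have := @floyd_metric_geometric v (fun k => u (i0 + k)%N) (m - i0) (mu ^+ N) mu.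
  rewrite addn0 subnKC//; apply; rewrite ?exprn_ge0 ?ltW//.
  + move=> k ki; rewrite ugeo; lia.
  + move=> k ki; apply: bound; lia.
Qed.

Lemma karlsson_bound_small (c : R) : 0 < c ->
  exists N, karlsson_bound N <= c /\ lam%:num ^+ N / (1 - lam%:num) <= c.
Proof.
move=> c0; pose q := karlsson_ratio.
have q0 : 0 < q := karlsson_ratio_gt0; have q1 : q < 1 := karlsson_ratio_lt1.
have l1 : 0 < 1 - lam%:num by rewrite subr_gt0.
have q1' : 0 < 1 - q by rewrite subr_gt0.
have small (x a : R) : 0 < x < 1 -> 0 < a -> \forall n \near \oo, x ^+ n <= a.
  move=> /andP[x0 x1] a0.
  have /cvg_expr/cvgrPdist_le/(_ _ a0) : `|x| < 1 by rewrite gtr0_norm.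
  by apply: filterS => n; rewrite sub0r normrN ger0_norm// exprn_ge0// ltW.
have [N _ HN] : \forall n \near \oo,
    q ^+ n <= c * (1 - q) / 2 /\ lam%:num ^+ n <= c * (1 - lam%:num).
  apply: filterI; apply: small; rewrite ?q0 ?lam_gt0 ?divr_gt0 ?mulr_gt0//=.
have [h1 h2] := HN N (leqnn N).
exists N; rewrite ler_pdivrMr// h2; split=> //.
by rewrite /karlsson_bound -/q mulrA ler_pdivrMr// mulrC -ler_pdivlMr.
Qed.

End FloydEstimates.

(** * Floyd metrics on the completion *)

Section CompletionDist.
Variables (R : realType) (T : choiceType) (d : pseudo_dist R T).

Lemma completion_dist_ge0 (x y : completion d) : 0 <= completion_dist x y.
Proof.
have := completion_dist_triangle y x x.
by rewrite completion_distxx (completion_dist_sym y); lra.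
Qed.

Lemma completion_dist_class_cvg (a b : nat -> T)
    (ca : cauchy_for d a) (cb : cauchy_for d b) :
  d (a n) (b n) @[n --> \oo] -->
    completion_dist (completion_class ca) (completion_class cb).
Proof.
set A := completion_class ca; set B := completion_class cb.
apply/cvgrPdist_lt => e e0; have e30 : 0 < e / 3 by lra.
have [NA HA] := completion_class_seq ca e30.
have [NB HB] := completion_class_seq cb e30.
have /cvgrPdist_lt /(_ _ e30)[N _ HN] := @completion_dist_cvg _ _ d A B.
exists (maxn N (maxn NA NB)) => // n /=; rewrite !geq_max => /and3P[nN nA nB].
have := HN n nN; have := HA n nA; have := HB n nB; rewrite /= -/A -/B.
set a' := completion_seq A n; set b' := completion_seq B n => hB hA.
have h1 := pdist_triangle d a' (a n) (b n).
have h2 := pdist_triangle d b' a' (b n).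
have h3 := pdist_triangle d (a n) a' b'.
have h4 := pdist_triangle d (b n) (a n) b'.
have h5 := pdist_sym d (a n) a'; have h6 := pdist_sym d (b n) b'.
by rewrite !ltr_norml => /andP[h7 h8]; apply/andP; split; lra.
Qed.

Lemma completion_dist_in (x y : T) :
  completion_dist (completion_in d x) (completion_in d y) = d x y.
Proof.
have := completion_dist_class_cvg
  (ca := @cauchy_for_cst _ _ d x) (cb := @cauchy_for_cst _ _ d y).
by move=> /cvg_lim <- //; rewrite lim_cst.
Qed.

End CompletionDist.

Section FloydRho.
Variables (R : realType) (G : groupType) (S : gen_set G).
Variables (lam : {itv R & `]0, 1[}) (o : G).
Let M := floyd_completion S lam o.
Implicit Types (x y z : M) (v : G).

Let lam_gt0 : 0 < lam%:num :> R. Proof. by []. Qed.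

Lemma cauchy_rebase v (a : nat -> G) :
  cauchy_for (floyd_dist S lam o) a -> cauchy_for (floyd_dist S lam v) a.
Proof.
move=> ca e e0; have k0 := exprn_gt0 (word_dist S o v) lam_gt0.
have [N HN] := ca _ (mulr_gt0 k0 e0); exists N => m n mN nN.
rewrite -(ltr_pM2l k0); apply: le_lt_trans (HN m n mN nN).
exact: floyd_metric_rebase.
Qed.

(** The identity of the vertex set is bi-Lipschitz for the Floyd metrics with
    base points [o] and [v]; this is its extension to the completions. *)
Definition rebase v x : completion (floyd_dist S lam v) :=
  completion_class (cauchy_rebase v (@completion_seq_cauchy _ _ _ x)).

Lemma floyd_rho_cvg v x y :
  floyd_metric S lam v (completion_seq x n) (completion_seq y n) @[n --> \oo]
    --> completion_dist (rebase v x) (rebase v y).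
Proof. exact: completion_dist_class_cvg. Qed.

Lemma floyd_rhoE v x y :
  floyd_rho v x y = completion_dist (rebase v x) (rebase v y).
Proof. exact/cvg_lim/floyd_rho_cvg. Qed.

Lemma rebase_vertex v (g : G) :
  rebase v (vertex S lam o g) = vertex S lam v g.
Proof.
apply/completion_class_eqP => e e0.
have k0 := exprn_gt0 (word_dist S o v) lam_gt0.
have [N HN] := completion_class_seq (@cauchy_for_cst _ _ (floyd_dist S lam o) g)
  (mulr_gt0 k0 e0).
exists N => n nN; rewrite -(ltr_pM2l k0); apply: le_lt_trans (HN n nN).
exact: floyd_metric_rebase.
Qed.

Lemma floyd_rho_vertex v (g h : G) :
  floyd_rho v (vertex S lam o g) (vertex S lam o h) = floyd_metric S lam v g h.
Proof. by rewrite floyd_rhoE !rebase_vertex completion_dist_in. Qed.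

Lemma floyd_rho_ge0 v x y : 0 <= floyd_rho v x y.
Proof. by rewrite floyd_rhoE completion_dist_ge0. Qed.

Lemma floyd_rho_sym v x y : floyd_rho v x y = floyd_rho v y x.
Proof. by rewrite !floyd_rhoE completion_dist_sym. Qed.

Lemma floyd_rho_triangle v y x z :
  floyd_rho v x z <= floyd_rho v x y + floyd_rho v y z.
Proof. by rewrite !floyd_rhoE completion_dist_triangle. Qed.

Lemma floyd_rho_rebase v w x y :
  lam%:num ^+ word_dist S w v * floyd_rho v x y <= floyd_rho w x y.
Proof.
rewrite !floyd_rhoE; have Cw := @floyd_rho_cvg w x y.
have Cv : lam%:num ^+ word_dist S w v *
      floyd_metric S lam v (completion_seq x n) (completion_seq y n) @[n --> \oo]
    --> lam%:num ^+ word_dist S w v * completion_dist (rebase v x) (rebase v y).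
  by apply: (@cvgM R nat); [exact: cvg_cst|exact: floyd_rho_cvg].
rewrite -(cvg_lim (@Rhausdorff R) Cv) -(cvg_lim (@Rhausdorff R) Cw).
apply: ler_lim; [exact: cvgP Cv|exact: cvgP Cw|].
by apply: nearW => n; exact: floyd_metric_rebase.
Qed.

Lemma floyd_rho_eq0 x y : floyd_rho o x y <= 0 -> x = y.
Proof.
move=> xy; apply: completion_dist_positivity; apply/le_anti.
by rewrite (completion_dist_ge0 x y) andbT.
Qed.

Lemma right_limit_small v (c : int -> G) (z : floyd_boundary S lam o) e :
  right_limit c z -> 0 < e ->
  exists N : nat, forall n, (N <= n)%N ->
    floyd_rho v (vertex S lam o (c n%:Z)) (val z) < e.
Proof.
move=> cz e0; have k0 := exprn_gt0 (word_dist S o v) lam_gt0.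
have /cz[N _ HN] :
    nbhs (val z : M) (ball (val z : M) (lam%:num ^+ word_dist S o v * e)).
  by apply: nbhsx_ballx; exact: mulr_gt0.
exists N => n nN; have := HN n nN; rewrite /= => zn.
rewrite -(ltr_pM2l k0); apply: le_lt_trans (floyd_rho_rebase v o _ _) _.
by rewrite floyd_rho_sym.
Qed.

(** Upper bounds for the Floyd metric pass to the endpoint of a ray. *)
Lemma right_limit_le v (c : int -> G) (z : floyd_boundary S lam o) x C :
  right_limit c z ->
  (exists N, forall n, (N <= n)%N ->
     floyd_rho v x (vertex S lam o (c n%:Z)) <= C) ->
  floyd_rho v x (val z) <= C.
Proof.
move=> cz [N HN]; apply/ler_addgt0Pr => e e0.
have [N' HN'] := right_limit_small v cz e0.
apply: le_trans (floyd_rho_triangle v (vertex S lam o (c (maxn N N')%:Z)) _ _) _.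
by apply: lerD; [apply: HN; exact: leq_maxl|apply/ltW/HN'/leq_maxr].
Qed.

End FloydRho.

(** * Geodesic rays and lines as seen from a vertex *)

Section RaysAndLines.
Variables (R : realType) (G : groupType) (S : gen_set G).
Variables (lam : {itv R & `]0, 1[}) (o : G).
Implicit Types (v : G) (c : int -> G) (z w : floyd_boundary S lam o).

Lemma ray_karlsson v c z (i0 : int) N : right_limit c z ->
  (forall i j, i0 <= i -> i0 <= j -> word_dist S (c i) (c j) = `|i - j|%N) ->
  (forall i, i0 <= i -> (N <= word_dist S v (c i))%N) ->
  floyd_rho v (vertex S lam o (c i0)) (val z) <= karlsson_bound lam N.
Proof.
move=> cz cgeo cN; apply: (right_limit_le cz); exists `|i0|%N => n ni0.
rewrite floyd_rho_vertex.
have := @karlsson R G S lam v (fun k => c (i0 + k%:Z)) `|n%:Z - i0|%N N.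
have -> : i0 + `|n%:Z - i0|%N%:Z = n%:Z by lia.
rewrite addr0; apply=> [i j _ _|i _]; last by apply: cN; lia.
by rewrite cgeo; lia.
Qed.

Lemma ray_near v c z (i0 : int) N : right_limit c z ->
  (forall i j, i0 <= i -> i0 <= j -> word_dist S (c i) (c j) = `|i - j|%N) ->
  karlsson_bound lam N < floyd_rho v (vertex S lam o (c i0)) (val z) ->
  exists2 i, i0 <= i & (word_dist S v (c i) < N)%N.
Proof.
move=> cz cgeo; apply: contraPP => far.
apply/negP; rewrite -leNgt; apply: ray_karlsson cz cgeo _ => i i0i.
by rewrite leqNgt; apply/negP => iN; apply: far; exists i.
Qed.

Lemma line_near v c z w N : left_limit c z -> right_limit c w ->
  (forall i j, word_dist S (c i) (c j) = `|i - j|%N) ->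
  karlsson_bound lam N < floyd_rho v (val z) (val w) ->
  exists i, (word_dist S v (c i) < N)%N.
Proof.
move=> cz cw cgeo; apply: contraPP => far.
apply/negP; rewrite -leNgt; apply: (right_limit_le cw); exists 0%N => n _.
rewrite floyd_rho_sym -[n%:Z]opprK.
apply: (@ray_karlsson v (fun i => c (- i))) cz _ _ => [i j _ _|i _].
  by rewrite cgeo; lia.
by rewrite leqNgt; apply/negP => iN; apply: far; exists (- i).
Qed.

Section RayFromBase.
Variable (c : int -> G).
Hypotheses (cgeo : geodesic S ray_dom c) (c0 : c 0 = o).

Lemma geodesic_ray_dist i j : 0 <= i -> 0 <= j ->
  word_dist S (c i) (c j) = `|i - j|%N.
Proof. by case: cgeo => _ _; apply. Qed.

Lemma ray_base_dist (n : nat) : word_dist S o (c n%:Z) = n.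
Proof. by rewrite -c0 geodesic_ray_dist//; lia. Qed.

Lemma ray_tail_le z (i : nat) : right_limit c z ->
  floyd_rho o (vertex S lam o (c i%:Z)) (val z) <=
    lam%:num ^+ i / (1 - lam%:num).
Proof.
move=> cz; apply: (right_limit_le cz); exists i => n ni.
rewrite floyd_rho_vertex.
have := @floyd_metric_escape R G S lam o (fun k => c (i + k)%N%:Z) (n - i) i.
rewrite addn0 subnKC//; apply=> k _.
  by rewrite geodesic_ray_dist//; lia.
by rewrite ray_base_dist.
Qed.

End RayFromBase.

Definition fellow_constant (M : nat) : R :=
  (2 / (1 - lam%:num) + M%:R) / lam%:num ^+ M.

Lemma fellow_constant_gt0 M : 0 < fellow_constant M.
Proof.
rewrite /fellow_constant divr_gt0 ?exprn_gt0//.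
Qed.

(** Follow the first ray backwards from its end to its vertex at distance [i]
    from [o], cross over to the second ray, and follow it to its end: all three
    pieces stay at distance about [i] or more from [o]. *)
Lemma fellow_rays_le a b z w (i j M : nat) :
  geodesic S ray_dom a -> a 0 = o -> right_limit a z ->
  geodesic S ray_dom b -> b 0 = o -> right_limit b w ->
  (word_dist S (a i%:Z) (b j%:Z) <= M)%N ->
  floyd_rho o (val z) (val w) <= fellow_constant M * lam%:num ^+ i.
Proof.
move=> ageo a0 az bgeo b0 bw abM.
have l0 : 0 < lam%:num :> R by [].
have l1 : 0 < 1 - lam%:num :> R by rewrite subr_gt0.
have ai := ray_base_dist ageo a0 i; have bj := ray_base_dist bgeo b0 j.
have tri := word_dist_triangle S (b j%:Z) o (a i%:Z).
rewrite (word_dist_sym S (b _)) ai bj in tri.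
pose t : R := lam%:num ^+ (i - M).
have t0 : 0 < t by rewrite exprn_gt0.
have H1 := ray_tail_le ageo a0 i az; have H2 := ray_tail_le bgeo b0 j bw.
have H3 := floyd_metric_coarse S lam o (a i%:Z) (b j%:Z).
apply: le_trans (floyd_rho_triangle o (vertex S lam o (a i%:Z)) _ _) _.
have H4 := floyd_rho_triangle o (vertex S lam o (b j%:Z))
  (vertex S lam o (a i%:Z)) (val w).
rewrite floyd_rho_vertex in H4; rewrite floyd_rho_sym.
have tail (k : nat) : (i - M <= k)%N ->
    lam%:num ^+ k / (1 - lam%:num) <= t / (1 - lam%:num).
  by move=> ik; rewrite ler_pM2r ?invr_gt0// exp_lam_le.
have cross : floyd_metric S lam o (a i%:Z) (b j%:Z) <= M%:R * t.
  apply: le_trans H3 _; rewrite ai; apply: ler_pM; rewrite ?ler0n ?exprn_ge0//.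
    by rewrite ler_nat.
  by apply: exp_lam_le; lia.
have tM : t <= lam%:num ^+ i / lam%:num ^+ M.
  by rewrite ler_pdivlMr ?exprn_gt0// -exprD exp_lam_le//; lia.
have := tail i (leq_subr _ _); have := tail j ltac:(lia) => T1 T2.
apply: (@le_trans _ _ ((2 / (1 - lam%:num) + M%:R) * t)); first by lra.
rewrite /fellow_constant mulrAC -mulrA; apply: ler_wpM2l => //.
Qed.

End RaysAndLines.

(** * Comparison with the distance to a line *)

Section Comparison.
Variables (R : realType) (G : groupType) (S : gen_set G).
Variables (lam : {itv R & `]0, 1[}) (o : G).
Implicit Types (a b c : int -> G) (z w : floyd_boundary S lam o).

(** Let [c k] be the vertex of the line nearest to [o].  If [v] sees a large
    distance between [o] and [c k], then it is not much farther from [o] than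
    [c k]; otherwise [v] is close to the half-line from [c k] to [w].  Likewise
    for [v'] and the other half-line.  If both half-lines come close to [v], then
    so does [c k], which lies between. *)
Lemma dist_le_line_dist (kappa : R) N c z w (v v' : G) :
  karlsson_bound lam N <= kappa / 2 ->
  lam%:num ^+ N / (1 - lam%:num) <= kappa / 2 ->
  geodesic S setT c -> left_limit c z -> right_limit c w ->
  kappa < floyd_rho v (vertex S lam o o) (val w) ->
  kappa < floyd_rho v' (vertex S lam o o) (val z) ->
  (word_dist S o v <= set_dist S o (range c) + 3 * N + word_dist S v v')%N.
Proof.
move=> NK NL [_ _ cgeo] cz cw vw v'z.
have cdist i j : word_dist S (c i) (c j) = `|i - j|%N by exact: cgeo.
have [k <- _] := set_dist_range S 0 o c.
have shadow u :
    floyd_rho u (vertex S lam o o) (vertex S lam o (c k)) <= kappa / 2 \/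
    (word_dist S o u < word_dist S o (c k) + N)%N.
  rewrite floyd_rho_vertex; have [far|] := leqP (word_dist S o (c k) + N) (word_dist S o u);
    last by right.
  left; apply: le_trans NL; apply: floyd_metric_shadow.
  by rewrite addnC (word_dist_sym S u).
have vv'o := word_dist_triangle S v' o v; rewrite (word_dist_sym S v' v) in vv'o.
have [r1|r1] := shadow v; last by move: r1; clear; lia.
have [r2|r2] := shadow v'; last by move: r2 vv'o; clear; lia.
have kw : kappa / 2 < floyd_rho v (vertex S lam o (c k)) (val w).
  have := floyd_rho_triangle v (vertex S lam o (c k)) (vertex S lam o o) (val w).
  by move: r1 vw; clear; lra.
have kz : kappa / 2 < floyd_rho v' (vertex S lam o (c k)) (val z).
  have := floyd_rho_triangle v' (vertex S lam o (c k)) (vertex S lam o o) (val z).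
  by move: r2 v'z; clear; lra.
have [k1 kk1 vk1] := ray_near cw (fun i j _ _ => cdist i j) (le_lt_trans NK kw).
have [||k2 kk2 vk2] :=
    @ray_near R G S lam o v' (fun i => c (- i)) z (- k) N cz _ _.
- by move=> i1 i2 _ _; rewrite cdist; clear; lia.
- by rewrite opprK; exact: le_lt_trans NK kz.
have t1 := word_dist_triangle S v (c k1) (c (- k2)).
have t2 := word_dist_triangle S v' v (c (- k2)).
have t3 := word_dist_triangle S (c k) o v.
have t4 := word_dist_triangle S (c k1) (c k) v.
rewrite (word_dist_sym S (c k1) v) in t1 t4.
move: t1 t2 t3 t4 kk1 vk1 kk2 vk2; rewrite !cdist; clear; lia.
Qed.

(** [delta v] stands for the distance, seen from [v], between the ends of the two
    rays.  By the triangle inequality a transition point of [a] either lies close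
    to [b] or sees the two ends apart.  The transition points of [a] cannot all
    lie close to [b], as otherwise the two rays would have the same end; the first
    one that does not is preceded by one that does (or it is close to [o]). *)
Lemma branching_point (kappa : R) N l (delta : G -> R) a b za zb (T : set nat) :
  karlsson_bound lam N <= kappa / 2 ->
  geodesic S ray_dom a -> a 0 = o -> right_limit a za ->
  geodesic S ray_dom b -> b 0 = o -> right_limit b zb ->
  (forall n, exists m, [/\ T m, (n <= m + l)%N & (m <= n + l)%N]) ->
  (forall m, T m -> kappa <
     floyd_rho (a m%:Z) (vertex S lam o o) (val zb) + delta (a m%:Z)) ->
  za <> zb ->
  exists i j, [/\ T i, kappa / 2 < delta (a i%:Z) &
    (word_dist S (a i%:Z) (b j%:Z) <= N + 2 * l + 1)%N].
Proof.
move=> NK ageo a0 az bgeo b0 bz denseT Tzb zazb.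
have near_b i : T i -> delta (a i%:Z) <= kappa / 2 ->
    exists j : nat, (word_dist S (a i%:Z) (b j%:Z) < N)%N.
  move=> Ti di; have kv := Tzb i Ti.
  have [||j j0 vj] := @ray_near R G S lam o (a i%:Z) b zb 0 N bz _ _.
  - exact: geodesic_ray_dist bgeo.
  - by rewrite b0; apply: le_lt_trans NK _; move: di kv; clear; lra.
  - by exists `|j|%N; rewrite gez0_abs.
have ex : exists i, `[< T i /\ kappa / 2 < delta (a i%:Z) >].
  apply: contrapT => none; apply: zazb; apply/val_inj/floyd_rho_eq0.
  have fc0 := fellow_constant_gt0 lam N.
  apply/ler_addgt0Pr => e e0; rewrite add0r.
  have : \forall k \near \oo, lam%:num ^+ k <= e / fellow_constant lam N.
    have /cvg_expr/cvgrPdist_le/(_ _ (divr_gt0 e0 fc0)) : `|lam%:num : R| < 1.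
      by rewrite gtr0_norm.
    by apply: filterS => k; rewrite sub0r normrN ger0_norm// exprn_ge0// ltW.
  move=> [k _ Hk]; have [i [Ti ki _]] := denseT (k + l)%N.
  have di : delta (a i%:Z) <= kappa / 2.
    by rewrite leNgt; apply/negP => ?; apply: none; exists i; apply/asboolP.
  have [j ij] := near_b i Ti di.
  apply: le_trans (fellow_rays_le ageo a0 az bgeo b0 bz (ltnW ij)) _.
  by rewrite mulrC -ler_pdivlMr//; apply: Hk; rewrite /= -(leq_add2r l).
have [i /asboolP[Ti di] imin] := ex_minnP ex.
have [il|il] := leqP i (2 * l).
  exists i, 0%N; split=> //; rewrite b0 word_dist_sym (ray_base_dist ageo a0).
  by move: il; clear; lia.
have [i' [Ti' h1 h2]] := denseT (i - l.+1)%N.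
have di' : delta (a i'%:Z) <= kappa / 2.
  rewrite leNgt; apply/negP => di'.
  have /imin : `[< T i' /\ kappa / 2 < delta (a i'%:Z) >] by apply/asboolP.
  by move: il h1 h2; clear; lia.
have [j ij] := near_b i' Ti' di'.
exists i, j; split=> //; apply: leq_trans (word_dist_triangle S (a i'%:Z) _ _) _.
by rewrite (geodesic_ray_dist ageo)//; move: il h1 h2 ij; clear; lia.
Qed.

(** The two estimates in abstract form, for any family [delta] of functions that
    behaves like the distances, seen from the various vertices, between the ends
    of the line [c].  With [a i] the branching point, [delta o] is comparable to
    [lam ^+ i], and [i] differs from the distance of [o] to [c] by a bounded
    amount. *)
Lemma line_comparison (kappa : R) (l : nat) : 0 < kappa ->
  exists A B : R, [/\ 0 < A, 0 < B &
    forall (delta : G -> R) a b c (Ta Tb : set nat) za zb z w,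
    geodesic S ray_dom a -> a 0 = o -> right_limit a za ->
    geodesic S ray_dom b -> b 0 = o -> right_limit b zb ->
    geodesic S setT c -> left_limit c z -> right_limit c w ->
    (forall n, exists m, [/\ Ta m, (n <= m + l)%N & (m <= n + l)%N]) ->
    (forall n, exists m, [/\ Tb m, (n <= m + l)%N & (m <= n + l)%N]) ->
    (forall m, Ta m -> kappa <
       floyd_rho (a m%:Z) (vertex S lam o o) (val zb) + delta (a m%:Z)) ->
    (forall m, Ta m -> kappa < floyd_rho (a m%:Z) (vertex S lam o o) (val w)) ->
    (forall m, Tb m -> kappa < floyd_rho (b m%:Z) (vertex S lam o o) (val z)) ->
    (forall v, delta v <= floyd_rho v (val z) (val w)) ->
    delta o <= floyd_rho o (val za) (val zb) ->
    (forall v, lam%:num ^+ word_dist S o v * delta v <= delta o) ->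
    za <> zb ->
    A * lam%:num ^+ set_dist S o (range c) <= delta o
      <= B * lam%:num ^+ set_dist S o (range c)].
Proof.
move=> k0; have k20 : 0 < kappa / 2 by lra.
have [N [NK NL]] := karlsson_bound_small lam k20.
pose M := (N + 2 * l + 1)%N; pose C := (3 * N + (M + l))%N.
exists (lam%:num ^+ C * (kappa / 2)), (fellow_constant lam M / lam%:num ^+ N).
split; first by rewrite mulr_gt0 ?exprn_gt0.
  by rewrite divr_gt0 ?fellow_constant_gt0 ?exprn_gt0.
move=> delta a b c Ta Tb za zb z w ageo a0 az bgeo b0 bz cgeo cz cw.
move=> densea denseb Tazb Taw Tbz delta_line delta_rays delta_rebase zazb.
have [i [j [Ti di ij]]] :=
  branching_point NK ageo a0 az bgeo b0 bz densea Tazb zazb.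
have oi := ray_base_dist ageo a0 i.
apply/andP; split.
- have [j' [Tj' jj' j'j]] := denseb j.
  have iC : (i <= C + set_dist S o (range c))%N.
    have vv' : (word_dist S (a i%:Z) (b j'%:Z) <= M + l)%N.
      apply: leq_trans (word_dist_triangle S (b j%:Z) _ _) _.
      by rewrite leq_add// (geodesic_ray_dist bgeo)//; move: jj' j'j; clear; lia.
    have := dist_le_line_dist NK NL cgeo cz cw (Taw i Ti) (Tbz j' Tj').
    by rewrite oi; move: vv'; rewrite /C /M; clear; lia.
  apply: le_trans (delta_rebase (a i%:Z)); rewrite oi mulrAC -exprD.
  by apply: ler_pM; rewrite ?exprn_ge0 ?(ltW k20) ?(ltW di) ?exp_lam_le.
- have iN : (set_dist S o (range c) <= i + N)%N.
    have [||k vk] := @line_near R G S lam o (a i%:Z) c z w N cz cw.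
    + by case: cgeo => _ _ H i1 i2; exact: H.
    + exact: le_lt_trans NK (lt_le_trans di (delta_line _)).
    have nk : (set_dist S o (range c) <= word_dist S o (c k))%N.
      by have [_ _] := set_dist_range S 0 o c; exact.
    have := word_dist_triangle S (a i%:Z) o (c k).
    by rewrite oi; move: vk nk; clear; lia.
  apply: le_trans delta_rays _.
  apply: le_trans (fellow_rays_le ageo a0 az bgeo b0 bz ij) _.
  rewrite -mulrA; apply: ler_wpM2l; first exact/ltW/fellow_constant_gt0.
  by rewrite mulrC ler_pdivlMr ?exprn_gt0// -exprD exp_lam_le.
Qed.

End Comparison.

(** * The shortcut metric *)

Section ShortcutMetric.
Variables (R : realType) (G : groupType) (S : gen_set G).
Variables (lam : {itv R & `]0, 1[}) (o : G).
Variables (X : topologicalType) (F : floyd_boundary S lam o -> X).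
Implicit Types (v g : G) (x y : X + G) (p q : floyd_completion S lam o).

Definition chain_len v (c : floyd_completion S lam o * floyd_completion S lam o) cs :
  R := \sum_(a <- c :: cs) floyd_rho v a.1 a.2.

Lemma chain_len_ge0 v c cs : 0 <= chain_len v c cs.
Proof. by apply: sumr_ge0 => a _; exact: floyd_rho_ge0. Qed.

Lemma shortcut_tilde_le v p q c cs : shortcut_chain F p q c cs ->
  shortcut_tilde F v p q <= chain_len v c cs.
Proof.
move=> ccs; apply: ge_inf; last by exists c, cs.
by exists 0 => _ [c' [cs' [_ ->]]]; exact: chain_len_ge0.
Qed.

Lemma shortcut_tilde_glb v p q r :
  (forall c cs, shortcut_chain F p q c cs -> r <= chain_len v c cs) ->
  r <= shortcut_tilde F v p q.
Proof.
move=> H; apply: lb_le_inf; last by move=> _ [c [cs [ccs ->]]]; exact: H.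
by exists (chain_len v (p, q) [::]), (p, q), [::]; split.
Qed.

Lemma shortcut_rho_le v x y p q c cs : fibre F x p -> fibre F y q ->
  shortcut_chain F p q c cs -> shortcut_rho F v x y <= chain_len v c cs.
Proof.
move=> xp yq ccs; apply: le_trans (shortcut_tilde_le v ccs).
apply: ge_inf; last by exists p => //; exists q.
exists 0 => _ [p' _ [q' _ <-]].
by apply: shortcut_tilde_glb => c' cs' _; exact: chain_len_ge0.
Qed.

Lemma shortcut_rho_le_floyd v x y p q : fibre F x p -> fibre F y q ->
  shortcut_rho F v x y <= floyd_rho v p q.
Proof.
move=> xp yq; have := @shortcut_rho_le v x y p q (p, q) [::] xp yq.
by rewrite /chain_len big_seq1; apply; split.
Qed.

Lemma shortcut_rho_glb v x y p0 q0 r : fibre F x p0 -> fibre F y q0 ->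
  (forall p q c cs, fibre F x p -> fibre F y q -> shortcut_chain F p q c cs ->
     r <= chain_len v c cs) ->
  r <= shortcut_rho F v x y.
Proof.
move=> xp0 yq0 H; apply: lb_le_inf.
  by exists (shortcut_tilde F v p0 q0), p0 => //; exists q0.
move=> _ [p xp [q yq <-]]; apply: shortcut_tilde_glb => c cs; exact: H.
Qed.

Lemma shortcut_rho_rebase v w x y p0 q0 : fibre F x p0 -> fibre F y q0 ->
  lam%:num ^+ word_dist S w v * shortcut_rho F v x y <= shortcut_rho F w x y.
Proof.
move=> xp0 yq0; apply: shortcut_rho_glb xp0 yq0 _ => p q c cs xp yq ccs.
have k0 : 0 <= lam%:num ^+ word_dist S w v by rewrite exprn_ge0.
apply: le_trans (ler_wpM2l k0 (shortcut_rho_le v xp yq ccs)) _.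
by rewrite /chain_len mulr_sumr; apply: ler_sum => a _; exact: floyd_rho_rebase.
Qed.

(** A chain from the fibre of [xi] can be prolonged by a first step that leads to
    any other point of this fibre. *)
Lemma shortcut_rho_triangle v x xi eta p z w :
  fibre F x p -> F z = xi -> F w = eta ->
  shortcut_rho F v x (inl eta) <=
    floyd_rho v p (val z) + shortcut_rho F v (inl xi) (inl eta).
Proof.
move=> xp zxi weta; rewrite -lerBlDl.
have xiz : fibre F (inl xi) (val z) by exists z.
have etaw : fibre F (inl eta) (val w) by exists w.
apply: shortcut_rho_glb xiz etaw _ => p' q c cs [z' z'xi <-] etaq [cz' cq ccs].
rewrite lerBlDl.
have := @shortcut_rho_le v x (inl eta) p q (p, val z) (c :: cs) xp etaq.
rewrite [leRHS]big_cons; apply; split=> //=.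
rewrite ccs andbT; apply/asboolP; exists z, z'; split=> //.
by rewrite zxi z'xi.
Qed.

End ShortcutMetric.

(** * Transitional rays *)

Section TransitionalRays.
Variables (R : realType) (G : groupType) (S : gen_set G).
Variables (lam : {itv R & `]0, 1[}) (o : G).
Variables (cosets : set (set G)) (eps r : R).

Lemma transitional_ray_dense (L : R) a n : 0 < L ->
  transitional_ray_from S o cosets eps r L a ->
  exists m : nat, [/\ transition S cosets eps r ray_dom a m%:Z,
    (n <= m + Num.bound L)%N & (m <= n + Num.bound L)%N].
Proof.
move=> L0 [_ _ /(_ n%:Z isT)[j tj jn]].
have j0 : 0 <= j by case: tj.
have {}jn : (`|n%:Z - j| < Num.bound L)%N.
  rewrite -(ltr_nat R); apply: le_lt_trans jn _.
  exact/archi_boundP/ltW.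
by exists `|j|%N; rewrite gez0_abs//; split=> //; move: jn j0; clear; lia.
Qed.

Variables (X : topologicalType) (F : floyd_boundary S lam o -> X).

Lemma transitional_ray_visible : visible_transition F cosets eps r ->
  exists2 kappa : R, 0 < kappa & forall L a z i,
    transitional_ray_from S o cosets eps r L a -> right_limit a z ->
    transition S cosets eps r ray_dom a i ->
    kappa < shortcut_rho F (a i) (inr o) (inl (F z)).
Proof.
move=> [kappa k0 H]; exists kappa => // L a z i [ageo a0 _] az ti.
apply: H ti; first exact: ageo.
- by exists 0, 1.
- exists 0; split; rewrite /ray_dom /= ?oppr0//.
  by move=> j; rewrite oppr_ge0.
- split; last by exists z.
  by move=> j; exists (`|j| + 1); rewrite /ray_dom /=; lia.
Qed.

End TransitionalRays.

(** * Distances between uniformly conical points *)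

Theorem theorem1p6 (R : realType) (G : groupType) (S : gen_set G)
  (X : metricType R) (act : G -> X -> X)
  (X_compact : compact [set: X])
  (act_conv : convergence_action act)
  (act_gf : geometrically_finite act)
  (o : G)
  (lam1 : R) (lam1_01 : 0 < lam1 < 1)
  (F : forall lam : {itv R & `]0, 1[}, floyd_boundary S lam o -> X)
  (F_floyd : forall lam : {itv R & `]0, 1[}, lam1 <= lam%:num ->
     is_floyd_map act (F lam))
  (reps : set (set G)) (reps_conj : conj_representatives act reps)
  (mu1 D1 : R) (mu1_gt0 : 0 < mu1) (D1_gt0 : 0 < D1)
  (contr : contracting S (left_cosets reps) mu1 D1)
  (Rf : R -> R) (Rf_inter : bounded_intersection S (left_cosets reps) Rf)
  (eps r : R)
  (cond_a : mu1 < eps)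
  (cond_b : forall lam : {itv R & `]0, 1[}, lam1 <= lam%:num ->
     visible_transition (F lam) (left_cosets reps) eps r)
  (cond_c : deep_between S (left_cosets reps) eps)
  (cond_d : Rf eps < r)
  (cond_e : forall lam : {itv R & `]0, 1[}, lam1 <= lam%:num ->
     uniformly_conical_by_rays act (F lam) (left_cosets reps) eps r) :
  exists lam0 : R, [/\ 0 < lam0 < 1, lam1 <= lam0 &
    forall (L : R) (lam : {itv R & `]0, 1[}), 0 < L -> lam0 <= lam%:num ->
    exists C : R, [/\ 1 <= C,
      forall xi eta : floyd_boundary S lam o,
        uc_boundary (left_cosets reps) eps r L xi ->
        uc_boundary (left_cosets reps) eps r L eta ->
        xi <> eta ->
        forall gamma, boundary_line xi eta gamma ->
        let n := set_dist S o (range gamma) in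
        C^-1 * lam%:num ^+ n <= boundary_rho o xi eta <= C * lam%:num ^+ n &
      forall xi eta : X,
        uc_limit act (F lam) (left_cosets reps) eps r L xi ->
        uc_limit act (F lam) (left_cosets reps) eps r L eta ->
        xi <> eta ->
        forall gamma, limit_line (F lam) xi eta gamma ->
        let n := set_dist S o (range gamma) in
        C^-1 * lam%:num ^+ n <= shortcut_rho (F lam) o (inl xi) (inl eta)
          <= C * lam%:num ^+ n]].
Proof.
exists lam1; split=> // L lam L0 /cond_b vis.
have [kappa k0 visible] := transitional_ray_visible vis.
have [A [B [A0 B0 compare]]] := line_comparison S lam o (Num.bound L) k0.
have fibreo : fibre (F lam) (inr o) (vertex S lam o o) by [].
have fibrez (z : floyd_boundary S lam o) : fibre (F lam) (inl (F lam z)) (val z).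
  by exists z.
have seen a z w i : transitional_ray_from S o (left_cosets reps) eps r L a ->
    right_limit a z -> F lam z = F lam w ->
    transition S (left_cosets reps) eps r ray_dom a i ->
    kappa < floyd_rho (a i) (vertex S lam o o) (val w).
  move=> ta az zw ti; apply: lt_le_trans (visible L a z i ta az ti) _.
  by rewrite zw; exact: shortcut_rho_le_floyd.
have final (delta : R) n : A * lam%:num ^+ n <= delta <= B * lam%:num ^+ n ->
    (1 + B + A^-1)^-1 * lam%:num ^+ n <= delta <= (1 + B + A^-1) * lam%:num ^+ n.
  have A'0 : 0 < A^-1 by rewrite invr_gt0.
  have l0 : 0 <= lam%:num ^+ n by rewrite exprn_ge0.
  move=> /andP[lo hi]; apply/andP; split.
    apply: le_trans lo; apply: ler_wpM2r => //.
    by rewrite -[leRHS]invrK lef_pV2 ?posrE; lra.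
  by apply: le_trans hi _; apply: ler_wpM2r => //; lra.
exists (1 + B + A^-1); split.
- by have : 0 < A^-1 by [rewrite invr_gt0]; lra.
- move=> xi eta [_ [b tb bxi]] [_ [a ta aeta]] xieta c [cgeo cxi ceta].
  apply: final; have [ageo a0 _] := ta; have [bgeo b0 _] := tb.
  apply: (compare (fun v => boundary_rho v xi eta) a b c _ _ eta xi xi eta
    ageo a0 aeta bgeo b0 bxi cgeo cxi ceta
    (fun n => transitional_ray_dense n L0 ta)
    (fun n => transitional_ray_dense n L0 tb)).
  + move=> m tm; apply: lt_le_trans (floyd_rho_triangle _ _ _ _).
    exact: seen ta aeta _ tm.
  + by move=> m; exact: seen ta aeta _.
  + by move=> m; exact: seen tb bxi _.
  + by [].
  + by rewrite floyd_rho_sym.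
  + by move=> v; exact: floyd_rho_rebase.
  + exact/nesym.
- move=> xi eta [_ [b tb [zb bzb zbxi]]] [_ [a ta [za aza zaeta]]] xieta c.
  move=> [z [w [zxi weta [cgeo cz cw]]]].
  apply: final; have [ageo a0 _] := ta; have [bgeo b0 _] := tb.
  have fz : fibre (F lam) (inl xi) (val z) by exists z.
  have fw : fibre (F lam) (inl eta) (val w) by exists w.
  have fzb : fibre (F lam) (inl xi) (val zb) by exists zb.
  have fza : fibre (F lam) (inl eta) (val za) by exists za.
  apply: (compare (fun v => shortcut_rho (F lam) v (inl xi) (inl eta)) a b c _ _
    za zb z w ageo a0 aza bgeo b0 bzb cgeo cz cw
    (fun n => transitional_ray_dense n L0 ta)
    (fun n => transitional_ray_dense n L0 tb)).
  + move=> m tm; apply: lt_le_trans (visible L a za _ ta aza tm) _.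
    by rewrite zaeta; exact: shortcut_rho_triangle fibreo zbxi weta.
  + by move=> m; apply: seen ta aza _; rewrite zaeta.
  + by move=> m; apply: seen tb bzb _; rewrite zbxi.
  + by move=> v; exact: shortcut_rho_le_floyd.
  + by rewrite floyd_rho_sym; exact: shortcut_rho_le_floyd.
  + by move=> v; exact: shortcut_rho_rebase fz fw.
  + by move=> zab; apply: xieta; rewrite -zbxi -zaeta zab.
Qed.
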